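(* Let $N\ge 1$. For every signed diagram $D$ on the nodes $1,\dots,N-1$, the diagram demipotent $C_D\in\mathbb{C}H_0(S_N)$ is demipotent, and it yields an idempotent $$I_D = C_{D_1}C_{D_2}\cdots C_{D_{N-1}} = C_D^{\,N},$$ where $D_i$ denotes the signed diagram consisting of the first $i$ entries of $D$ (so $D_{N-1}=D$). The collection $\{I_D\}$, with $D$ ranging over all $2^{N-1}$ signed diagrams on the nodes $1,\dots,N-1$, is a set of mutually orthogonal primitive idempotents of $\mathbb{C}H_0(S_N)$ whose sum is $1$.
   Context: The $0$-Hecke monoid $H_0(S_N)$ is generated by $\pi_1,\dots,\pi_{N-1}$ with relations $\pi_i^2=\pi_i$; $\pi_i\pi_j=\pi_j\pi_i$ for $|i-j|>1$; $\pi_i\pi_{i+1}\pi_i=\pi_{i+1}\pi_i\pi_{i+1}$. Its elements are indexed by permutations: $\sigma\in S_N$ corresponds to $\pi_{i_1}\cdots\pi_{i_k}$ for any reduced word $s_{i_1}\cdots s_{i_k}$ of $\sigma$. The $0$-Hecke algebra $\mathbb{C}H_0(S_N)$ is its monoid algebra over $\mathbb{C}$. For $M\le N$, $\mathbb{C}H_0(S_M)$ is identified with the subalgebra generated by $\pi_1,\dots,\pi_{M-1}$. Put $\bar\pi_i=1-\pi_i$; the $\bar\pi_i$ satisfy the same relations, and $\Psi$ is the algebra automorphism with $\Psi(\pi_i)=\bar\pi_i$. For $J\subseteq\{1,\dots,N-1\}$, $w_J^+$ is the longest element of the submonoid generated by $\{\pi_i : i\in J\}$, and $w_J^-=\Psi(w_J^+)$.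 A signed diagram $D$ on the nodes $1,\dots,n$ is an assignment of a sign $+$ or $-$ to each node $1,\dots,n$ (for $n=0$ the empty diagram). Let $P_1,\dots,P_m$ be the maximal intervals of consecutive nodes with the same sign, listed in increasing order, and let $sgn(k)$ be the common sign on $P_k$. Set $L_D=w_{P_1}^{sgn(1)}w_{P_2}^{sgn(2)}\cdots w_{P_m}^{sgn(m)}$ and $R_D=w_{P_m}^{sgn(m)}w_{P_{m-1}}^{sgn(m-1)}\cdots w_{P_1}^{sgn(1)}$. The diagram demipotent is $C_D=L_DR_D$ (equal to $1$ for the empty diagram). An element $x$ of an algebra is demipotent if there is some $k$ with $x^k=x^{k+1}$. *)

(* Defs.v *)
From HB Require Import structures.
From mathcomp Require Import all_boot all_order all_algebra generic_quotient.
From mathcomp Require Import boolp classical_sets reals.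
From mathcomp Require Import complex.
From mathcomp Require Import monalg.
Set Implicit Arguments. Unset Strict Implicit. Unset Printing Implicit Defensive.
Import GRing.Theory.
Local Open Scope quotient_scope.

(* Nodes and generators are numbered from 0: i : 'I_N.-1 stands for the
   generator pi_(i+1) of H_0(S_N). *)
Inductive hecke_rel (N : nat) : seq 'I_N.-1 -> seq 'I_N.-1 -> Prop :=
| hecke_idem (i : 'I_N.-1) : hecke_rel [:: i; i] [:: i]
| hecke_comm (i j : 'I_N.-1) :
    (i.+1 < j) || (j.+1 < i) ->
    hecke_rel [:: i; j] [:: j; i]
| hecke_braid (i j : 'I_N.-1) : j = i.+1 :> nat ->
    hecke_rel [:: i; j; i] [:: j; i; j].

Inductive hecke_cong (N : nat) : seq 'I_N.-1 -> seq 'I_N.-1 -> Prop :=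
| hecke_cong_refl u : hecke_cong u u
| hecke_cong_sym u v : hecke_cong u v -> hecke_cong v u
| hecke_cong_trans v u w : hecke_cong u v -> hecke_cong v w -> hecke_cong u w
| hecke_cong_step p s u v :
    hecke_rel u v -> hecke_cong (p ++ u ++ s) (p ++ v ++ s).

Lemma hecke_cong_ctx N (p s u v : seq 'I_N.-1) :
  hecke_cong u v -> hecke_cong (p ++ u ++ s) (p ++ v ++ s).
Proof.
elim=> [w|x y _ h|y x w _ h1 _ h2|p' s' x y h].
- exact: hecke_cong_refl.
- exact: hecke_cong_sym.
- exact: hecke_cong_trans h1 h2.
by have := hecke_cong_step (p ++ p') (s' ++ s) h; rewrite -!catA.
Qed.

Lemma hecke_cong_cat N (u u' v v' : seq 'I_N.-1) :
  hecke_cong u u' -> hecke_cong v v' -> hecke_cong (u ++ v) (u' ++ v').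
Proof.
move=> /(hecke_cong_ctx [::] v) /= h1 /(hecke_cong_ctx u' [::]).
by rewrite !cats0; apply: hecke_cong_trans h1.
Qed.

Lemma hecke_cong_nilp N (u v : seq 'I_N.-1) : hecke_cong u v -> nilp u = nilp v.
Proof.
elim=> // [y x w _ -> _ -> //|p s x y [i|i j _|i j _]];
  by rewrite /nilp !size_cat !addnA !addnS.
Qed.

Definition hecke_congb N : rel (seq 'I_N.-1) := fun u v => `[< hecke_cong u v >].

Lemma hecke_congb_equiv N : equiv_class_of (@hecke_congb N).
Proof.
split.
- by move=> u; apply/asboolP/hecke_cong_refl.
- by move=> u v; apply/asboolP/asboolP; apply: hecke_cong_sym.
by move=> v u w /asboolP h1 /asboolP h2; apply/asboolP/(hecke_cong_trans h1 h2).
Qed.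

Canonical hecke_equiv N : equiv_rel (seq 'I_N.-1) :=
  EquivRelPack (hecke_congb_equiv N).

(* The monoid H_0(S_N). *)
Definition hecke_monoid N : Type := {eq_quot (hecke_equiv N)}.
HB.instance Definition _ N := Choice.on (hecke_monoid N).
HB.instance Definition _ N := EqQuotient.on (hecke_monoid N).

Definition hecke_word N (u : seq 'I_N.-1) : hecke_monoid N :=
  \pi_(hecke_monoid N) u.

Lemma hecke_wordP N (u v : seq 'I_N.-1) :
  hecke_word u = hecke_word v <-> hecke_cong u v.
Proof.
by split=> [/eqmodP/asboolP//|h]; apply/eqmodP/asboolP.
Qed.

Lemma hecke_wordK N (x : hecke_monoid N) : hecke_word (repr x) = x.
Proof. exact: reprK. Qed.

Lemma repr_hecke_word N (u : seq 'I_N.-1) : hecke_cong (repr (hecke_word u)) u.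
Proof. by apply/hecke_wordP; rewrite hecke_wordK. Qed.

Definition hecke_mul N (x y : hecke_monoid N) : hecke_monoid N :=
  hecke_word (repr x ++ repr y).

Lemma hecke_mul_word N (u v : seq 'I_N.-1) :
  hecke_mul (hecke_word u) (hecke_word v) = hecke_word (u ++ v).
Proof. by apply/hecke_wordP/hecke_cong_cat; apply: repr_hecke_word. Qed.

Lemma hecke_mulA N : associative (@hecke_mul N).
Proof.
move=> x y z; rewrite -(hecke_wordK x) -(hecke_wordK y) -(hecke_wordK z).
by rewrite !hecke_mul_word catA.
Qed.

Lemma hecke_mul1m N : left_id (hecke_word [::]) (@hecke_mul N).
Proof. by move=> x; rewrite -(hecke_wordK x) hecke_mul_word. Qed.

Lemma hecke_mulm1 N : right_id (hecke_word [::]) (@hecke_mul N).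
Proof. by move=> x; rewrite -(hecke_wordK x) hecke_mul_word cats0. Qed.

Lemma hecke_unitm N (x y : hecke_monoid N) :
  hecke_mul x y = hecke_word [::] ->
  x = hecke_word [::] /\ y = hecke_word [::].
Proof.
rewrite -{2}(hecke_wordK x) -{2}(hecke_wordK y) /hecke_mul.
move=> /hecke_wordP/hecke_cong_nilp.
by case: (repr x) => [|//]; case: (repr y).
Qed.

HB.instance Definition _ N := Choice_isMonomialDef.Build (hecke_monoid N)
  (@hecke_mulA N) (@hecke_mul1m N) (@hecke_mulm1 N) (@hecke_unitm N).

Lemma hecke_length_subproof N (x : hecke_monoid N) :
  exists l, `[< exists2 u, size u = l & hecke_word u = x >].
Proof.
by exists (size (repr x)); apply/asboolP; exists (repr x); rewrite ?hecke_wordK.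
Qed.

(* The length of the permutation indexing x, i.e. the common length of its
   reduced words, is the least length of a word in the generators equal to x. *)
Definition hecke_length N (x : hecke_monoid N) : nat :=
  ex_minn (hecke_length_subproof x).

Definition in_submonoid N (J : {set 'I_N.-1}) (x : hecke_monoid N) : Prop :=
  exists2 u, all [in J] u & hecke_word u = x.

Definition is_longest N (J : {set 'I_N.-1}) (w : hecke_monoid N) : Prop :=
  in_submonoid J w /\
  forall x, in_submonoid J x -> hecke_length x <= hecke_length w.

(* Exactly one w satisfies is_longest J w, so the default is never returned. *)
Definition longest N (J : {set 'I_N.-1}) : hecke_monoid N :=
  xget (hecke_word [::]) [set w | is_longest J w].

Local Open Scope ring_scope.

Notation hecke_algebra K N := {malg K[hecke_monoid N]}.

Definition hecke_elt (K : fieldType) N (x : hecke_monoid N) : hecke_algebra K N :=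
  << x >>.
Definition hecke_gen (K : fieldType) N (i : 'I_N.-1) : hecke_algebra K N :=
  hecke_elt K (hecke_word [:: i]).
Definition hecke_bar (K : fieldType) N (i : 'I_N.-1) : hecke_algebra K N :=
  1 - hecke_gen K i.

Definition hecke_bar_prod (K : fieldType) N (x : hecke_monoid N) :
  hecke_algebra K N := \prod_(i <- repr x) hecke_bar K i.

(* The automorphism exchanging pi_i and 1 - pi_i, as the linear extension of
   its values on the monoid (see hecke_psi_gen, hecke_psiK and the ring
   morphism structure below). *)
Definition hecke_psi (K : fieldType) N (a : hecke_algebra K N) :
  hecke_algebra K N := mmap malgC (@hecke_bar_prod K N) a.

Lemma idem_1B (A : pzRingType) (x : A) :
  x * x = x -> (1 - x) * (1 - x) = 1 - x.
Proof. by move=> xx; rewrite mulrBr mulr1 mulrBl mul1r xx subrr subr0. Qed.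

Lemma comm_1B (A : pzRingType) (x y : A) :
  x * y = y * x -> (1 - x) * (1 - y) = (1 - y) * (1 - x).
Proof.
move=> xy; rewrite !mulrBl !mul1r !mulrBr !mulr1 xy !opprB !addrA.
by rewrite [LHS](ACl (1*4*3*2)).
Qed.

Lemma braid_1B (A : pzRingType) (x y : A) :
  x * x = x -> y * y = y -> x * (y * x) = y * (x * y) ->
  (1 - x) * ((1 - y) * (1 - x)) = (1 - y) * ((1 - x) * (1 - y)).
Proof.
have E (a b : A) : a * a = a ->
    (1 - a) * ((1 - b) * (1 - a)) = 1 - a + (a * b - a * (b * a) + (b * a - b)).
  move=> aa; rewrite [(1 - b) * _]mulrBl mul1r mulrBr idem_1B //.
  by rewrite [b * (1 - a)]mulrBr mulr1 [_ * (b - _)]mulrBl mul1r mulrBr !opprB.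
move=> xx yy xyx; rewrite !E // xyx !addrA.
by rewrite [LHS](ACl (1*6*5*4*3*2)).
Qed.

Lemma hecke_rel_1B (A : pzRingType) N (f : 'I_N.-1 -> A) :
  (forall u v, hecke_rel u v -> \prod_(i <- u) f i = \prod_(i <- v) f i) ->
  forall u v, hecke_rel u v ->
    \prod_(i <- u) (1 - f i) = \prod_(i <- v) (1 - f i).
Proof.
move=> fP; have ff i : f i * f i = f i.
  by have := fP _ _ (hecke_idem i); rewrite !big_cons big_nil !mulr1.
move=> u v h; have := fP _ _ h.
case: h => [i|i j _|i j _]; rewrite !big_cons !big_nil !mulr1.
- exact: idem_1B.
- exact: comm_1B.
by apply: braid_1B.
Qed.

Section Psi.
Variables (K : fieldType) (N : nat).
Local Notation A := (hecke_algebra K N).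
Local Notation gen := (@hecke_gen K N).
Local Notation bar := (@hecke_bar K N).

Lemma hecke_eltM x y : hecke_elt K x * hecke_elt K y = hecke_elt K (@hecke_mul N x y).
Proof. by rewrite /hecke_elt malgM_def fgmulUU mulr1. Qed.

Lemma hecke_elt_word (u : seq 'I_N.-1) :
  hecke_elt K (hecke_word u) = \prod_(i <- u) gen i.
Proof.
elim: u => [|i u IH]; first by rewrite big_nil.
by rewrite big_cons -IH hecke_eltM hecke_mul_word.
Qed.

Lemma hecke_genP (u v : seq 'I_N.-1) : hecke_rel u v ->
  \prod_(i <- u) gen i = \prod_(i <- v) gen i.
Proof.
move=> h; rewrite -!hecke_elt_word; congr hecke_elt.
by apply/hecke_wordP; have := hecke_cong_step [::] [::] h; rewrite !cats0.
Qed.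

Lemma hecke_barP (u v : seq 'I_N.-1) : hecke_rel u v ->
  \prod_(i <- u) bar i = \prod_(i <- v) bar i.
Proof. exact: hecke_rel_1B hecke_genP _ _. Qed.

Lemma hecke_bar_cong (u v : seq 'I_N.-1) : hecke_cong u v ->
  \prod_(i <- u) bar i = \prod_(i <- v) bar i.
Proof.
elim=> [//|x y _ -> //|y x w _ -> _ -> //|p s x y h].
by rewrite !big_cat /= (hecke_barP h).
Qed.

Lemma hecke_bar_prod_word (u : seq 'I_N.-1) :
  hecke_bar_prod K (hecke_word u) = \prod_(i <- u) bar i.
Proof. exact/hecke_bar_cong/repr_hecke_word. Qed.

Lemma hecke_bar_prod_mmorphism : mmorphism (@hecke_bar_prod K N).
Proof.
split=> [x y|]; last by rewrite hecke_bar_prod_word big_nil.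
rewrite -(hecke_wordK x) -(hecke_wordK y).
by rewrite [mmul _ _]hecke_mul_word !hecke_bar_prod_word big_cat.
Qed.
HB.instance Definition _ := isMultiplicative.Build (hecke_monoid N) A
  (@hecke_bar_prod K N) hecke_bar_prod_mmorphism.

Lemma malgC_monoid_morphism :
  monoid_morphism (malgC : K -> {malg K[hecke_monoid N]}).
Proof. by split=> // x y; rewrite malgM_def fgmulUU mulm1. Qed.
HB.instance Definition _ := GRing.isMonoidMorphism.Build K {malg K[hecke_monoid N]}
  malgC malgC_monoid_morphism.

HB.instance Definition _ := GRing.Additive.copy (@hecke_psi K N)
  (mmap (malgC : K -> {malg K[hecke_monoid N]}) (@hecke_bar_prod K N)).


Lemma malgC_comm (c : K) (a : {malg K[hecke_monoid N]}) : GRing.comm c%:MP a.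
Proof.
rewrite /GRing.comm mul_malgC malgM_def fgmulgU malgZ_def.
by apply: eq_bigr => k _; rewrite mulrC mulm1.
Qed.

Lemma hecke_psi_monoid_morphism : monoid_morphism (@hecke_psi K N).
Proof.
have [h1 h2] := @commr_mmap_is_multiplicative _ _ _ malgC (@hecke_bar_prod K N)
  (fun a x y => malgC_comm a@_x (hecke_bar_prod K y)).
by split.
Qed.
HB.instance Definition _ := GRing.isMonoidMorphism.Build A A (@hecke_psi K N)
  hecke_psi_monoid_morphism.

Lemma hecke_psi_elt (x : hecke_monoid N) :
  hecke_psi (hecke_elt K x) = hecke_bar_prod K x.
Proof. by rewrite /hecke_psi mmapU mul1r. Qed.

Lemma hecke_psi_gen i : hecke_psi (gen i) = bar i.
Proof. by rewrite hecke_psi_elt hecke_bar_prod_word big_seq1. Qed.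

Lemma hecke_psi_bar i : hecke_psi (bar i) = gen i.
Proof.
rewrite /hecke_bar.
have -> : hecke_psi (1 - gen i) = hecke_psi 1 - hecke_psi (gen i).
  exact: raddfB.
by rewrite hecke_psi_gen rmorph1 subKr.
Qed.

Lemma hecke_psiD : {morph @hecke_psi K N : a b / a + b}.
Proof. exact: raddfD. Qed.

Lemma hecke_psiZ (c : K) (a : A) : hecke_psi (c *: a) = c *: hecke_psi a.
Proof. by rewrite /hecke_psi mmapZ mul_malgC. Qed.

Lemma hecke_psiK : involutive (@hecke_psi K N).
Proof.
move=> a; rewrite [a]monalgE.
elim/big_ind: _ => [|b c hb hc|x _].
- by rewrite !raddf0.
- apply: etrans (congr1 _ (hecke_psiD b c)) _.
  exact: etrans (hecke_psiD _ _) (congr2 +%R hb hc).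
have -> : << a@_x *g x >> = a@_x *: hecke_elt K x.
  by apply/malgP => y; rewrite mcoeffZ /hecke_elt !mcoeffU mulrnAr mulr1.
rewrite !hecke_psiZ hecke_psi_elt -(hecke_wordK x) hecke_bar_prod_word.
rewrite hecke_elt_word rmorph_prod; by congr (_ *: _); apply: eq_bigr => i _; apply: hecke_psi_bar.
Qed.
End Psi.

Definition hecke_w (K : fieldType) N (s : bool) (J : {set 'I_N.-1}) :
  hecke_algebra K N :=
  let w := hecke_elt K (longest J) in if s then w else hecke_psi w.

(* A signed diagram is the sequence of its signs, true standing for +.
   [blocks] lists the maximal intervals of equal sign from left to right, each
   with its sign, as lists of positions starting at k. *)
Fixpoint blocks_from (k : nat) (D : seq bool) : seq (bool * seq nat) :=
  if D is s :: D' then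
    match blocks_from k.+1 D' with
    | (s', P) :: B =>
        if s == s' then (s, k :: P) :: B else (s, [:: k]) :: (s', P) :: B
    | [::] => [:: (s, [:: k])]
    end
  else [::].
Definition blocks : seq bool -> seq (bool * seq nat) := blocks_from 0.

Definition block_elt (K : fieldType) N (B : bool * seq nat) : hecke_algebra K N :=
  hecke_w K B.1 [set i : 'I_N.-1 | (i : nat) \in B.2].

(* These are meant for size D <= N.-1. *)
Definition diagL (K : fieldType) N (D : seq bool) : hecke_algebra K N :=
  \prod_(B <- blocks D) block_elt K N B.
Definition diagR (K : fieldType) N (D : seq bool) : hecke_algebra K N :=
  \prod_(B <- rev (blocks D)) block_elt K N B.
Definition diagC (K : fieldType) N (D : seq bool) : hecke_algebra K N :=
  diagL K N D * diagR K N D.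

Definition diagI (K : fieldType) N (D : seq bool) : hecke_algebra K N :=
  \prod_(1 <= i < N) diagC K N (take i D).

Definition demipotent (A : pzRingType) (x : A) : Prop :=
  exists k, x ^+ k = x ^+ k.+1.

Definition idempotent_elt (A : pzRingType) (e : A) : Prop := e * e = e.

Definition orthogonal_elts (A : pzRingType) (e f : A) : Prop :=
  e * f = 0 /\ f * e = 0.

Definition primitive_idempotent (A : pzRingType) (e : A) : Prop :=
  [/\ e != 0, idempotent_elt e
    & forall f g : A, idempotent_elt f -> idempotent_elt g ->
        orthogonal_elts f g -> e = f + g -> f = 0 \/ g = 0].

(* Main.v *)
From HB Require Import structures.
Require Import Defs.
From mathcomp Require Import all_boot all_order all_algebra.
From mathcomp Require Import finmap reals complex monalg.
From mathcomp Require classical_sets.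
From mathcomp Require Import boolp zify.
Set Implicit Arguments. Unset Strict Implicit. Unset Printing Implicit Defensive.
Import GRing.Theory.

(** The key fact is that siblings are orthogonal: C_{D+} C_{D-} = C_{D-} C_{D+} = 0.
Whatever the last sign of D is, C_{Ds} = L_D p^s R_D with p the next generator,
so that C_{D+} + C_{D-} = C_D.  Reading L_D and R_D from the inside out, C_{D+}
and C_{D-} are obtained from U = p and V = 1 - p by conjugating with the w_P of
the successive blocks P, the last one first.  The invariant of this process is
that U V = 0 and that, if s is the generator just below those conjugated so far,
T = U s V satisfies s T = 0 and T s = T (or s T = T and T s = 0, when one starts
from U = 1 - p and V = p); at node 1 only U V = 0 is left.  Consequently
C_D C_{Ds} = C_{Ds} C_D = C_{Ds}^2, from which stabilization of the powers,
orthogonality and completeness follow by induction on the tree of diagrams.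

For primitivity, an element x of the monoid acting on the left of y either fixes
y, when all the generators in x do, or increases its length.  Hence an idempotent
killed by the 2^(N-1) characters pi_i |-> 0, 1 is zero, and these characters form
a dual basis of the I_D. *)

(** * Bubble sort *)

(** The action of a generator of the monoid on one-line notations: it puts two neighbouring entries
    in decreasing order. Starting from the increasing list, [inversions] then measures length. *)
Fixpoint bubble (i : nat) (s : seq nat) : seq nat :=
  match i, s with
  | 0, x :: y :: t => if x < y then y :: x :: t else s
  | i'.+1, x :: t => x :: bubble i' t
  | _, _ => s
  end.

(** With this max/min form, each Hecke relation between bubbles is checked entry by entry by linear
    arithmetic. *)
Lemma nth_bubble i s k : i.+1 < size s ->
  nth 0 (bubble i s) k =
    if k == i then maxn (nth 0 s i) (nth 0 s i.+1)
    else if k == i.+1 then minn (nth 0 s i) (nth 0 s i.+1) else nth 0 s k.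
Proof.
elim: i s k => [|i IH] [|x s] k //; last first.
  by rewrite /= ltnS => lt_is; case: k => [|k] //=; rewrite IH.
case: s => [//|y t] _ /=.
by case: ltnP => xy; case: k => [|[|k]] //=; rewrite /maxn /minn; case: ltnP; lia.
Qed.

Lemma perm_bubble i s : perm_eq (bubble i s) s.
Proof.
elim: i s => [|i IH] [|x s] //=; last by rewrite perm_cons.
by case: s => [|y t] //; case: ltnP => // _; apply/permP => p /=; lia.
Qed.

Lemma size_bubble i s : size (bubble i s) = size s.
Proof. exact/perm_size/perm_bubble. Qed.

Lemma bubble_id i s : nth 0 s i.+1 <= nth 0 s i -> bubble i s = s.
Proof.
elim: i s => [|i IH] [|x s] //=; last by move/IH->.
by case: s => [|y t] //=; case: ltnP.
Qed.

Fixpoint inversions (s : seq nat) : nat :=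
  if s is x :: t then count (ltn^~ x) t + inversions t else 0.

Lemma inversions_bubble i s : i.+1 < size s -> nth 0 s i < nth 0 s i.+1 ->
  inversions (bubble i s) = (inversions s).+1.
Proof.
elim: i s => [|i IH] [|x s] //=; last first.
  by rewrite ltnS => lt_is /(IH _ lt_is)->; rewrite (permP (perm_bubble i s)) addnS.
case: s => [|y t] //= _ xy; rewrite xy /= xy ltnNge (ltnW xy) /= !addnA add0n.
by move: (count _ t) (count _ t); lia.
Qed.

(** A crude bound suffices: it makes lengths bounded, for the existence of longest elements and for
    the final argument on idempotents in the kernel of the characters. *)
Lemma inversions_leq s : inversions s <= size s * size s.
Proof.
elim: s => //= x s IH; have := count_size (ltn^~ x) s; move: (count _ s); nia.
Qed.

Lemma bubbleK i s : i.+1 < size s -> bubble i (bubble i s) = bubble i s.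
Proof.
by move=> h; apply: bubble_id; rewrite !nth_bubble // !eqxx; case: eqP; lia.
Qed.

Lemma bubble_comm i j s : i.+1 < size s -> j.+1 < size s ->
  (i.+1 < j) || (j.+1 < i) -> bubble i (bubble j s) = bubble j (bubble i s).
Proof.
move=> hi hj hij; apply: (@eq_from_nth _ 0); first by rewrite !size_bubble.
move=> k _; rewrite !nth_bubble ?size_bubble //.
by do ![case: eqP => //=]; lia.
Qed.

Lemma bubble_braid i s : i.+2 < size s ->
  bubble i (bubble i.+1 (bubble i s)) = bubble i.+1 (bubble i (bubble i.+1 s)).
Proof.
move=> hi; apply: (@eq_from_nth _ 0); first by rewrite !size_bubble.
have hi' : i.+1 < size s by lia.
move=> k _; rewrite !nth_bubble ?size_bubble ?eqxx //.
have [e1 e2 e3 e4 e5] : [/\ (i.+1 == i) = false, (i.+2 == i) = false,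
  (i.+2 == i.+1) = false, (i == i.+1) = false & (i == i.+2) = false].
  by split; lia.
rewrite !(e1, e2, e3, e4, e5, eqxx).
move: (nth 0 s i) (nth 0 s i.+1) (nth 0 s i.+2) => a b c.
by do ![case: eqP => //=]; lia.
Qed.

Definition bubble_word N (u : seq 'I_N.-1) : seq nat :=
  foldr (fun (i : 'I_N.-1) s => bubble i s) (iota 0 N) u.

Lemma perm_bubble_word N (u : seq 'I_N.-1) : perm_eq (bubble_word u) (iota 0 N).
Proof. by elim: u => //= i u; apply: perm_trans (perm_bubble _ _). Qed.

Lemma size_bubble_word N (u : seq 'I_N.-1) : size (bubble_word u) = N.
Proof. by rewrite (perm_size (perm_bubble_word u)) size_iota. Qed.

Lemma ltn_bubble_word N (u : seq 'I_N.-1) (i : 'I_N.-1) :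
  i.+1 < size (bubble_word u).
Proof. by rewrite size_bubble_word; case: N u i => [|N] ? [i /=]; lia. Qed.

Lemma nth_bubble_word_inj N (u : seq 'I_N.-1) (i j : nat) : i < N -> j < N ->
  nth 0 (bubble_word u) i = nth 0 (bubble_word u) j -> i = j.
Proof.
move=> hi hj /eqP; rewrite nth_uniq ?size_bubble_word // => [/eqP//|].
by rewrite (perm_uniq (perm_bubble_word u)) iota_uniq.
Qed.

Lemma bubble_word_cong N (u v : seq 'I_N.-1) :
  hecke_cong u v -> bubble_word u = bubble_word v.
Proof.
elim=> [//|x y _ -> //|y x w _ -> _ -> //|p s x y h].
rewrite /bubble_word !foldr_cat; congr foldr; rewrite -/(bubble_word s).
case: h => [i|i j ij|i j ij] /=.
- exact/bubbleK/ltn_bubble_word.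
- by apply: bubble_comm ij; apply: ltn_bubble_word.
have := ltn_bubble_word s j; rewrite ij; exact: bubble_braid.
Qed.

Definition descent N (i : 'I_N.-1) (u : seq 'I_N.-1) :=
  nth 0 (bubble_word u) i.+1 < nth 0 (bubble_word u) i.

Lemma descentPn N (i : 'I_N.-1) (u : seq 'I_N.-1) : 
  ~~ descent i u -> nth 0 (bubble_word u) i < nth 0 (bubble_word u) i.+1.
Proof.
rewrite -leqNgt leq_eqVlt => /orP[/eqP/nth_bubble_word_inj|//].
have := ltn_bubble_word u i; rewrite size_bubble_word => h.
by move=> /(_ (ltnW h) h); lia.
Qed.

(** * The exchange property *)

Section Exchange.
Variable N : nat.
Implicit Types (u v : seq 'I_N.-1) (i j : 'I_N.-1).

Lemma hecke_cong_cons i u v : hecke_cong u v -> hecke_cong (i :: u) (i :: v).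
Proof. by move=> h; have := hecke_cong_ctx [:: i] [::] h; rewrite !cats0. Qed.

Lemma hecke_rel_cat u v w : hecke_rel u v -> hecke_cong (u ++ w) (v ++ w).
Proof. exact: (hecke_cong_step [::]). Qed.

Lemma nth_cons_bubble_word i u k : nth 0 (bubble_word (i :: u)) k =
  if k == i then maxn (nth 0 (bubble_word u) i) (nth 0 (bubble_word u) i.+1)
  else if k == i.+1 then minn (nth 0 (bubble_word u) i) (nth 0 (bubble_word u) i.+1)
  else nth 0 (bubble_word u) k.
Proof. exact/nth_bubble/ltn_bubble_word. Qed.

(* When the first letter [j] of [u] is a neighbour of [i], the order of the three
   entries concerned decides whether [i] or [j] can be pulled out of the tail, or
   both can and a braid relation is needed. *)
Lemma exchange i u : descent i u ->
  exists2 v, size v < size u & hecke_cong u (i :: v).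
Proof.
have [n] := ubnP (size u); elim: n i u => // n IH i [|j u] /=.
  move=> _; rewrite /descent /=; have := ltn_bubble_word [::] i.
  rewrite size_iota => h; rewrite !nth_iota //; lia.
rewrite ltnS => lt_un.
have absorb k w v : hecke_cong w (k :: v) -> hecke_cong (k :: w) w.
  move=> wv; apply: hecke_cong_trans (hecke_cong_cons k wv) _.
  apply: (hecke_cong_trans _ (hecke_cong_sym wv)).
  exact: (hecke_rel_cat v (hecke_idem k)).
have [<- _|neq_ij] := eqVneq j i.
  by exists u => //; apply: hecke_cong_refl.
rewrite /descent; have [far|near] := boolP ((i.+1 < j) || (j.+1 < i)).
  rewrite !nth_cons_bubble_word.
  do 4![case: eqP => [?|_]; first lia].
  move=> /(IH i u lt_un) [v lt_vu uv].
  exists (j :: v) => //; apply: hecke_cong_trans (hecke_cong_cons j uv) _.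
  by apply: (hecke_rel_cat v (hecke_comm _)); rewrite orbC.
have adj : j = i.+1 :> nat \/ i = j.+1 :> nat.
  by move: neq_ij; rewrite -val_eqE /=; lia.
have braid v : hecke_cong [:: j, i, j & v] [:: i, j, i & v].
  have [ji|ij] := adj.
  - exact/hecke_cong_sym/(hecke_rel_cat v (hecke_braid ji)).
  exact: (hecke_rel_cat v (hecke_braid ij)).
have pull : descent i u -> (descent j u \/ forall v, hecke_cong u (i :: v) ->
    ~~ descent i v -> descent j v) ->
    exists2 v, size v < (size u).+1 & hecke_cong (j :: u) (i :: v).
  move=> di dj.
  have [v lt_vu uv] : exists2 v, size v < size u & hecke_cong u (i :: v).
    exact: IH.
  case: dj => [/(IH j u lt_un)[w _ /absorb uw]|dj].
    exists v; first exact: ltnW.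
    exact: hecke_cong_trans uw uv.
  (* The tail [v] is shortened until [i] is no longer a descent of it, which is when the second
     alternative in [dj] applies. *)
  have [m] := ubnP (size v); elim: m v lt_vu uv => // m IHm v lt_vu uv le_m.
  have [/(IH i v (ltn_trans lt_vu lt_un)) [w lt_wv vw]|ndi] := boolP (descent i v).
    apply: (IHm w); [exact: ltn_trans lt_vu| |exact: leq_trans lt_wv _].
    apply: (hecke_cong_trans uv); apply: (hecke_cong_trans _ vw).
    exact: absorb vw.
  have [w lt_wv vw] := IH j v (ltn_trans lt_vu lt_un) (dj v uv ndi).
  exists [:: j, i & w]; first by rewrite /=; lia.
  have uw := hecke_cong_trans uv (hecke_cong_cons i vw).
  apply: hecke_cong_trans (hecke_cong_cons j uw) _.
  exact: braid.
move=> di; apply: pull; move: di; rewrite /descent.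
  rewrite !nth_cons_bubble_word.
  by case: adj => ->; do ![case: eqP => ? //; try lia].
have [|le_u] := ltnP (nth 0 (bubble_word u) j.+1); first by left.
move=> di; right=> v /bubble_word_cong uv /descentPn; move: di le_u.
rewrite !nth_cons_bubble_word uv.
case: adj => adj; rewrite adj !nth_cons_bubble_word ?adj.
  by do ![case: eqP => ? //; try lia].
by do ![case: eqP => ? //; try lia].
Qed.
End Exchange.

(** * Length and longest elements *)

Section Length.
Variable N : nat.
Implicit Types (u v : seq 'I_N.-1) (i j : 'I_N.-1) (x y z : hecke_monoid N).
Local Notation w_ := (@hecke_word N).

Lemma inversions_cons i u : ~~ descent i u ->
  inversions (bubble_word (i :: u)) = (inversions (bubble_word u)).+1.
Proof. by move/descentPn; apply/inversions_bubble/ltn_bubble_word. Qed.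

Lemma descent_absorb i u : descent i u -> hecke_cong (i :: u) u.
Proof.
case/exchange=> v _ uv; apply: hecke_cong_trans (hecke_cong_cons i uv) _.
exact: hecke_cong_trans (hecke_rel_cat v (hecke_idem i)) (hecke_cong_sym uv).
Qed.

Lemma inversions_leq_size u : inversions (bubble_word u) <= size u.
Proof.
elim: u => [|i u IH] /=.
  rewrite leqn0; apply/eqP; rewrite /bubble_word /=.
  suff E n m : inversions (iota m n) = 0 by rewrite E.
  elim: n m => //= n IHn m; rewrite IHn addn0; apply/eqP; rewrite -leqn0 leqNgt.
  by rewrite -has_count; apply/hasPn => k; rewrite mem_iota /=; lia.
have [di|/inversions_cons /= -> //] := boolP (descent i u).
by rewrite bubble_id ?(ltnW di)// leqW.
Qed.

Lemma reduced_word u :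
  exists2 v, size v = inversions (bubble_word u) & hecke_cong v u.
Proof.
elim: u => [|i u [v sz_v vu]].
  exists [::]; last exact: hecke_cong_refl.
  by apply/eqP; rewrite eq_sym -leqn0; apply: (inversions_leq_size [::]).
have [di|ndi] := boolP (descent i u); last first.
  exists (i :: v); last exact: hecke_cong_cons.
  by rewrite inversions_cons //= sz_v.
exists v; first by rewrite sz_v /= bubble_id // ltnW.
exact: hecke_cong_trans vu (hecke_cong_sym (descent_absorb di)).
Qed.

Lemma hecke_length_word u : hecke_length (w_ u) = inversions (bubble_word u).
Proof.
rewrite /hecke_length; case: ex_minnP => m /asboolP [v <- /hecke_wordP vu] min_m.
apply/eqP; rewrite eqn_leq -{2}(bubble_word_cong vu) inversions_leq_size andbT.
have [v' <- /hecke_wordP v'u] := reduced_word u.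
by apply: min_m; apply/asboolP; exists v'.
Qed.

Lemma hecke_length_leq x : hecke_length x <= N * N.
Proof.
rewrite -(hecke_wordK x) hecke_length_word.
by have := inversions_leq (bubble_word (repr x)); rewrite size_bubble_word.
Qed.

Variant hecke_cons_spec i u : Prop :=
| HeckeConsAbsorb of w_ (i :: u) = w_ u
| HeckeConsLonger of hecke_length (w_ (i :: u)) = (hecke_length (w_ u)).+1.

Lemma hecke_consP i u : hecke_cons_spec i u.
Proof.
have [di|ndi] := boolP (descent i u).
  exact/HeckeConsAbsorb/hecke_wordP/descent_absorb.
by apply: HeckeConsLonger; rewrite !hecke_length_word inversions_cons.
Qed.

Lemma hecke_word_cons i u v : w_ u = w_ v -> w_ (i :: u) = w_ (i :: v).
Proof. by move/hecke_wordP/(hecke_cong_cons i)/hecke_wordP. Qed.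

Lemma hecke_word_absorb u v :
  {in u, forall i, w_ (i :: v) = w_ v} -> w_ (u ++ v) = w_ v.
Proof.
elim: u => //= i u IH h; rewrite -[RHS](h i) ?mem_head //.
by apply/hecke_word_cons/IH => j ju; apply: h; rewrite inE ju orbT.
Qed.

Lemma hecke_length_cat u v : hecke_length (w_ v) <= hecke_length (w_ (u ++ v)).
Proof.
elim: u => //= i u IH.
by case: (hecke_consP i (u ++ v)) => -> //; apply: leqW.
Qed.

(** Prepending letters never shortens, so equal lengths force the letters of [u], the innermost
    first, to be absorbed. *)
Lemma hecke_length_cat_eq u v :
  hecke_length (w_ (u ++ v)) = hecke_length (w_ v) ->
  {in u, forall i, w_ (i :: v) = w_ v}.
Proof.
elim: u => //= i u IH; have le := hecke_length_cat u v.
case: (hecke_consP i (u ++ v)) => [E|-> eq_len]; last by lia.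
rewrite E => /IH all_u j; have uv := hecke_word_absorb all_u.
rewrite inE => /orP[/eqP->|/all_u//].
by rewrite -uv -E; apply/hecke_word_cons.
Qed.

(** The set of relations is stable under reversal; this carries absorption on the left over to the
    right. *)
Lemma hecke_cong_rev u v : hecke_cong u v -> hecke_cong (rev u) (rev v).
Proof.
elim=> [w|x y _ h|y x w _ h1 _ h2|p s x y h].
- exact: hecke_cong_refl.
- exact: hecke_cong_sym.
- exact: hecke_cong_trans h1 h2.
rewrite !rev_cat -!catA; case: h => [i|i j ij|i j ij]; apply: hecke_cong_step.
- exact: hecke_idem.
- by apply: hecke_comm; rewrite orbC.
exact: hecke_braid.
Qed.

Lemma hecke_word_rev u v : w_ u = w_ v -> w_ (rev u) = w_ (rev v).
Proof. by move/hecke_wordP/hecke_cong_rev/hecke_wordP. Qed.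

Section Longest.
Variable J : {set 'I_N.-1}.

Lemma is_longest_exists : exists x, is_longest J x.
Proof.
pose P n := `[< exists2 x, in_submonoid J x & hecke_length x = n >].
have exP : exists n, P n.
  exists (hecke_length (w_ [::])); apply/asboolP; exists (w_ [::]) => //.
  by exists [::].
have leP n : P n -> n <= N * N.
  by move=> /asboolP[x _ <-]; apply: hecke_length_leq.
case: (ex_maxnP exP leP) => n /asboolP[x Jx <-] max_x.
by exists x; split=> // y Jy; apply: max_x; apply/asboolP; exists y.
Qed.

Lemma longestP : is_longest J (longest J).
Proof. exact: (classical_sets.xgetPex _ is_longest_exists). Qed.

(** A letter of [J] that is not absorbed would give a longer element of the submonoid. *)
Lemma is_longest_absorb u : is_longest J (w_ u) ->
  {in J, forall i, w_ (i :: u) = w_ u}.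
Proof.
case=> -[v vJ vu] max_u i iJ.
case: (hecke_consP i u) => // len_u.
suff /max_u : in_submonoid J (w_ (i :: u)) by rewrite len_u ltnn.
by exists (i :: v); rewrite /= ?iJ // (hecke_word_cons i vu).
Qed.

(* The reversed word is absorbing on the other side, so the two are equal. *)
Lemma longest_word : exists u, [/\ all [in J] u, longest J = w_ u,
  {in J, forall i, w_ (i :: u) = w_ u} & {in J, forall i, w_ (rcons u i) = w_ u}].
Proof.
have [[u uJ def_u] max_u] := longestP.
have absl : {in J, forall i, w_ (i :: u) = w_ u}.
  by apply: is_longest_absorb; rewrite def_u; split=> //; exists u.
have revK : w_ (rev u) = w_ u.
  have <- : w_ (rev u ++ u) = w_ u.
    apply: hecke_word_absorb => i; rewrite mem_rev => iu.
    exact/absl/(allP uJ).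
  have -> : rev u ++ u = rev (rev u ++ u) by rewrite rev_cat revK.
  apply: hecke_word_rev; apply/esym/hecke_word_absorb => i.
  rewrite mem_rev => iu; exact/absl/(allP uJ).
exists u; split=> // i iJ.
have /hecke_word_rev := absl i iJ; rewrite rev_cons revK => <-.
rewrite -!cats1 -!hecke_mul_word; congr hecke_mul; exact/esym.
Qed.
End Longest.

End Length.

(** * Absorbing elements of intervals *)

Local Open Scope ring_scope.

(* The last three fields hold when [z] is a product of [h k], [k] in [P]; unlike
   that condition they are insensitive to reindexing [h]. *)
Record absorber (A : pzRingType) (h : nat -> A) (P : seq nat) (z : A) : Prop :=
  Absorber {
    absl : {in P, forall k, h k * z = z};
    absr : {in P, forall k, z * h k = z};
    abs_genl : forall m, {in P, forall k, h k * m = m} -> z * m = m;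
    abs_genr : forall m, {in P, forall k, m * h k = m} -> m * z = m;
    abs_comm : forall m, {in P, forall k, h k * m = m * h k} -> z * m = m * z }.

Record hecke_family (A : pzRingType) (M : nat) (h : nat -> A) : Prop :=
  HeckeFamily {
    family_idem : forall k, (k < M)%N -> h k * h k = h k;
    family_comm : forall k l, (k.+1 < l)%N -> (l < M)%N -> h k * h l = h l * h k;
    family_braid : forall k, (k.+1 < M)%N ->
      h k * h k.+1 * h k = h k.+1 * h k * h k.+1 }.

Section Intervals.
Variables (A : pzRingType) (M : nat) (h : nat -> A) (Z : nat -> nat -> A).
Hypothesis fam : hecke_family M h.
Hypothesis absZ : forall a n, (a + n <= M)%N -> absorber h (iota a n) (Z a n).

Lemma interval_absl a n k : (a + n <= M)%N -> (a <= k < a + n)%N ->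
  h k * Z a n = Z a n.
Proof. by move=> /absZ/absl H ?; apply: H; rewrite mem_iota. Qed.

Lemma interval_absr a n k : (a + n <= M)%N -> (a <= k < a + n)%N ->
  Z a n * h k = Z a n.
Proof. by move=> /absZ/absr H ?; apply: H; rewrite mem_iota. Qed.

Lemma interval_genl a n m : (a + n <= M)%N ->
  (forall k, (a <= k < a + n)%N -> h k * m = m) -> Z a n * m = m.
Proof. by move=> /absZ/abs_genl H ?; apply: H => k; rewrite mem_iota; auto. Qed.

Lemma interval_genr a n m : (a + n <= M)%N ->
  (forall k, (a <= k < a + n)%N -> m * h k = m) -> m * Z a n = m.
Proof. by move=> /absZ/abs_genr H ?; apply: H => k; rewrite mem_iota; auto. Qed.

Lemma interval_comm a n m : (a + n <= M)%N ->
  (forall k, (a <= k < a + n)%N -> h k * m = m * h k) -> Z a n * m = m * Z a n.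
Proof. by move=> /absZ/abs_comm H ?; apply: H => k; rewrite mem_iota; auto. Qed.

Lemma interval_mull a n b p : (a + n <= M)%N -> (a <= b)%N -> (b + p <= a + n)%N ->
  Z b p * Z a n = Z a n.
Proof.
by move=> ? ? ?; apply: interval_genl => [|k ?]; [|apply: interval_absl]; lia.
Qed.

Lemma interval_mulr a n b p : (a + n <= M)%N -> (a <= b)%N -> (b + p <= a + n)%N ->
  Z a n * Z b p = Z a n.
Proof.
by move=> ? ? ?; apply: interval_genr => [|k ?]; [|apply: interval_absr]; lia.
Qed.

(** If every generator of the interval fixes [t], so does [Z a n]; the two hypotheses thus give two
    values of [Z a n * t]. The factorizations of [Z a n.+1] below are recognized in this way. *)
Lemma interval_eql a n t : (a + n <= M)%N -> Z a n * t = Z a n ->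
  (forall k, (a <= k < a + n)%N -> h k * t = t) -> t = Z a n.
Proof. by move=> le <- abs_t; rewrite interval_genl. Qed.

Lemma interval_eqr a n t : (a + n <= M)%N -> t * Z a n = Z a n ->
  (forall k, (a <= k < a + n)%N -> t * h k = t) -> t = Z a n.
Proof. by move=> le <- abs_t; rewrite interval_genr. Qed.

Lemma interval0 a : (a <= M)%N -> Z a 0 = 1.
Proof. by move=> ?; rewrite -[LHS]mulr1 interval_genl //; lia. Qed.

(** The essential point is left absorption of [h k]: below the last two nodes it commutes with the
    first factor, the last node is a matter of idempotence, and the last but one requires a braid
    relation. *)
Lemma interval_shiftl a n : (a + n < M)%N ->
  h (a + n) * Z a n * Z a.+1 n = Z a n.+1.
Proof.
elim: n => [|n IH] lt_anM.
  apply: interval_eql => [||k kP]; [lia| |].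
    by rewrite !interval0 ?mulr1 ?interval_absr //; lia.
  rewrite !interval0 ?mulr1; try lia.
  have -> : k = (a + 0)%N by lia.
  by rewrite (family_idem fam).
have {}IH : Z a n.+1 = h (a + n) * Z a n * Z a.+1 n by rewrite IH //; lia.
apply: interval_eql => [||k kP]; [lia| |].
  rewrite !mulrA interval_absr; [|lia|lia].
  by rewrite !interval_mulr //; lia.
have [ltk|] := ltnP k.+1 (a + n.+1).
  rewrite !mulrA (family_comm fam) // -[_ * h k * _]mulrA interval_absl //; lia.
have [->|kn] := eqVneq k (a + n.+1)%N.
  by rewrite !mulrA (family_idem fam).
move=> le_k; have -> : k = (a + n)%N by lia.
have comm : h (a + n.+1) * Z a n = Z a n * h (a + n.+1).
  by apply/esym/interval_comm => [|i ?]; [lia|rewrite (family_comm fam) //; lia].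
(* The induction hypothesis exposes [h (a + n)], and a copy of [h (a + n.+1)] extracted from the
   last factor moves left across [Z a n] to complete the braid. *)
have E : h (a + n.+1) * Z a n.+1 * Z a.+1 n.+1 =
    h (a + n) * h (a + n.+1) * h (a + n) * Z a n * Z a.+1 n.+1.
  rewrite {1}IH -!mulrA interval_mull; [|lia..].
  rewrite -[Z a.+1 n.+1 in LHS](@interval_absl _ _ (a + n.+1)); [|lia..].
  rewrite [Z a n * _]mulrA -comm !mulrA addnS -(family_braid fam) ?addnS //.
  by rewrite -addnS.
by rewrite E !mulrA (family_idem fam) //; lia.
Qed.

Lemma interval_shiftr a n : (a + n < M)%N ->
  Z a.+1 n * Z a n * h (a + n) = Z a n.+1.
Proof.
elim: n => [|n IH] lt_anM.
  apply: interval_eqr => [||k kP]; [lia| |].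
    by rewrite !interval0 ?mulr1 ?mul1r ?interval_absl //; lia.
  rewrite !interval0 ?mul1r; try lia.
  have -> : k = (a + 0)%N by lia.
  by rewrite (family_idem fam).
have {}IH : Z a n.+1 = Z a.+1 n * Z a n * h (a + n) by rewrite IH //; lia.
apply: interval_eqr => [||k kP]; [lia| |].
  rewrite -!mulrA interval_absl; [|lia|lia].
  by rewrite !interval_mull //; lia.
have [ltk|] := ltnP k.+1 (a + n.+1).
  rewrite -!mulrA -(family_comm fam) // [Z a n.+1 * _]mulrA interval_absr //; lia.
have [->|kn] := eqVneq k (a + n.+1)%N.
  by rewrite -!mulrA (family_idem fam).
move=> le_k; have -> : k = (a + n)%N by lia.
have comm : h (a + n.+1) * Z a n = Z a n * h (a + n.+1).
  by apply/esym/interval_comm => [|i ?]; [lia|rewrite (family_comm fam) //; lia].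
have E : Z a.+1 n.+1 * Z a n.+1 * h (a + n.+1) =
    Z a.+1 n.+1 * Z a n * (h (a + n) * h (a + n.+1) * h (a + n)).
  rewrite {1}IH !mulrA interval_mulr; [|lia..].
  rewrite -[Z a.+1 n.+1 in LHS](@interval_absr _ _ (a + n.+1)); [|lia..].
  rewrite -[_ * _ * Z a n]mulrA comm -!mulrA; congr (_ * (_ * _)).
  by rewrite !mulrA addnS (family_braid fam) // -addnS.
by rewrite E -!mulrA (family_idem fam) //; lia.
Qed.

(** Conjugating the next generator by a block extends the block: this is the case of a diagram that
    repeats its last sign. *)
Lemma interval_double a n : (a + n < M)%N ->
  Z a n * h (a + n) * Z a n = Z a n.+1.
Proof.
elim: n => [|n IH] lt_anM.
  by rewrite -interval_shiftl // !interval0 ?mul1r ?mulr1 //; lia.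
have {}IH : Z a n.+1 = Z a n * h (a + n) * Z a n by rewrite IH //; lia.
have comm : h (a + n.+1) * Z a n = Z a n * h (a + n.+1).
  by apply/esym/interval_comm => [|i ?]; [lia|rewrite (family_comm fam) //; lia].
apply: interval_eql => [||k kP]; [lia| |].
  by rewrite !mulrA interval_mulr ?interval_absr ?interval_mulr //; lia.
have [ltk|le_k] := ltnP k (a + n.+1).
  by rewrite !mulrA interval_absl //; lia.
have -> : k = (a + n.+1)%N by lia.
(* Only the left factor is expanded; its inner [Z a n] crosses [h (a + n.+1)] and is absorbed by the
   right factor. *)
have -> : Z a n.+1 * h (a + n.+1) * Z a n.+1 =
    Z a n * (h (a + n) * h (a + n.+1)) * Z a n.+1.
  rewrite {1}IH -!mulrA; congr (_ * (_ * _)).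
  by rewrite mulrA -comm -mulrA interval_mull //; lia.
have E t : h (a + n.+1) * (h (a + n) * (h (a + n.+1) * t)) =
    h (a + n) * (h (a + n.+1) * (h (a + n) * t)).
  by rewrite !mulrA addnS (family_braid fam) // -addnS.
rewrite !mulrA comm -!mulrA E; do 3!congr (_ * _).
by rewrite interval_absl //; lia.
Qed.

End Intervals.

(** * Reflection of the nodes *)

Section Mirror.
Variables (A : pzRingType) (M : nat) (h : nat -> A) (Z : nat -> nat -> A).
Hypothesis fam : hecke_family M h.
Hypothesis absZ : forall a n, (a + n <= M)%N -> absorber h (iota a n) (Z a n).

(** The reflection sends [k] to [M - k.+1] and exchanges the two ends of every interval, so the
    identities that add a node at the upper end yield those that add one at the lower end. *)
Let h' k := h (M - k.+1).
Let Z' a n := Z (M - (a + n)) n.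

Lemma mirror_family : hecke_family M h'.
Proof.
split=> [k ltk|k l ltkl ltl|k ltk]; rewrite /h'.
- by rewrite (family_idem fam) //; lia.
- by rewrite -(family_comm fam) //; lia.
have -> : (M - k.+1 = (M - k.+2).+1)%N by lia.
by rewrite -(family_braid fam) //; lia.
Qed.

Lemma mirror_absorber a n : (a + n <= M)%N -> absorber h' (iota a n) (Z' a n).
Proof.
move=> le; have le' : (M - (a + n) + n <= M)%N by lia.
have P k : k \in iota (M - (a + n)) n ->
    (M - k.+1)%N \in iota a n /\ h k = h' (M - k.+1).
  by rewrite !mem_iota /h' => ?; split; [lia | congr h; lia].
have P' k : k \in iota a n -> (M - k.+1)%N \in iota (M - (a + n)) n.
  by rewrite !mem_iota //; lia.
case: (absZ le') => zl zr gl gr c.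
split=> [k /P'/zl|k /P'/zr|m H|m H|m H]; rewrite /Z' //.
- by apply: gl => k /P[/H ? ->].
- by apply: gr => k /P[/H ? ->].
by apply: c => k /P[/H ? ->].
Qed.

Lemma interval_mirror_shiftl a n : (a + n < M)%N ->
  h a * Z a.+1 n * Z a n = Z a n.+1.
Proof.
move=> lt; have := interval_shiftl mirror_family mirror_absorber.
move=> /(_ (M - (a + n).+1)%N n); rewrite /h' /Z'.
have -> : (M - (M - (a + n).+1 + n).+1 = a)%N by lia.
have -> : (M - (M - (a + n).+1 + n) = a.+1)%N by lia.
have -> : (M - (M - (a + n).+1 + n.+1) = a)%N by lia.
by move=> H; apply: H; lia.
Qed.

Lemma interval_mirror_shiftr a n : (a + n < M)%N ->
  Z a n * Z a.+1 n * h a = Z a n.+1.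
Proof.
move=> lt; have := interval_shiftr mirror_family mirror_absorber.
move=> /(_ (M - (a + n).+1)%N n); rewrite /h' /Z'.
have -> : (M - (M - (a + n).+1 + n).+1 = a)%N by lia.
have -> : (M - (M - (a + n).+1 + n) = a.+1)%N by lia.
have -> : (M - (M - (a + n).+1 + n.+1) = a)%N by lia.
by move=> H; apply: H; lia.
Qed.

Lemma interval_mirror_double a n : (a + n < M)%N ->
  Z a.+1 n * h a * Z a.+1 n = Z a n.+1.
Proof.
move=> lt; have := interval_double mirror_family mirror_absorber.
move=> /(_ (M - (a + n).+1)%N n); rewrite /h' /Z'.
have -> : (M - (M - (a + n).+1 + n).+1 = a)%N by lia.
have -> : (M - (M - (a + n).+1 + n) = a.+1)%N by lia.
have -> : (M - (M - (a + n).+1 + n.+1) = a)%N by lia.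
by move=> H; apply: H; lia.
Qed.
End Mirror.

(** * Conjugation by a block *)

(* [U] and [V] play the part of elements of the algebra generated by the nodes
   from [b] on; the node [b.-1] is the only lower one they may not commute with. *)
Definition separated (A : pzRingType) (t : bool) (h : nat -> A) (b : nat)
    (U V : A) :=
  [/\ forall k, (k.+1 < b)%N -> h k * U = U * h k,
      forall k, (k.+1 < b)%N -> h k * V = V * h k,
      U * V = 0
    & forall c, b = c.+1 -> let T := U * h c * V in
        if t then h c * T = 0 /\ T * h c = T else h c * T = T /\ T * h c = 0].

(** Since [U * V = 0], passing from [h] to [1 - h] only changes the sign of [T], while it exchanges
    the eigenvalues 0 and 1. Blocks of sign - thereby reduce to blocks of sign +. *)
Lemma separated_1B (A : pzRingType) t (h : nat -> A) b U V :
  separated t h b U V -> separated (~~ t) (fun k => 1 - h k) b U V.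
Proof.
move=> [cU cV UV sep]; split=> // [k /cU E|k /cV E|c /sep].
- by rewrite mulrBl mulrBr mul1r mulr1 E.
- by rewrite mulrBl mulrBr mul1r mulr1 E.
have -> /= : U * (1 - h c) * V = - (U * h c * V).
  by rewrite mulrBr mulr1 mulrBl UV sub0r.
by case: t {sep} => /= -[E1 E2]; rewrite mulrBl mulrBr mul1r mulr1 !mulrN !mulNr;
   rewrite E1 E2 ?oppr0 ?addr0 ?subrr.
Qed.

Section Step.
Variables (A : pzRingType) (M : nat) (h : nat -> A) (Z : nat -> nat -> A).
Hypothesis fam : hecke_family M h.
Hypothesis absZ : forall a n, (a + n <= M)%N -> absorber h (iota a n) (Z a n).

(** [U] and [V] commute with the nodes below [a + n], so both the product of the conjugates and
    their new [T] reduce to the old [T] between longest elements. These absorb [s], which either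
    kills [T] or is absorbed by it, depending on the side. *)
Lemma separated_block t a n U V : (a + n < M)%N ->
  separated t h (a + n.+1) U V ->
  separated t h a (Z a n.+1 * U * Z a n.+1) (Z a n.+1 * V * Z a n.+1).
Proof.
move=> lt [cU cV UV sep]; set W := Z a n.+1.
move: {sep}(sep (a + n)%N (addnS _ _)) => /=; set s := h (a + n).
move defT: (U * s * V) => T sep.
have cW k : (k.+1 < a)%N -> h k * W = W * h k.
  move=> ltk; apply/esym/(interval_comm absZ) => [|i ?]; first by lia.
  by rewrite -(family_comm fam) //; lia.
have WW : W * W = W by apply: (interval_mull absZ); lia.
(* [interval_double] splits [Z b p.+1] at its last node; the outer factors then cross [U] and
   [V]. *)
have sandwich b p : (b + p = a + n)%N -> U * Z b p.+1 * V = Z b p * T * Z b p.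
  move=> bp; rewrite -(interval_double fam absZ); last by lia.
  have cUb : Z b p * U = U * Z b p.
    by apply: (interval_comm absZ) => [|k ?]; [lia|apply: cU; lia].
  have cVb : Z b p * V = V * Z b p.
    by apply: (interval_comm absZ) => [|k ?]; [lia|apply: cV; lia].
  by rewrite !mulrA -cUb -[_ * _ * V]mulrA cVb bp -/s -defT !mulrA.
split.
- move=> k ltk; rewrite !mulrA cW // -[W * _ * U]mulrA cU; last by lia.
  by rewrite mulrA -[_ * h k * W]mulrA cW // !mulrA.
- move=> k ltk; rewrite !mulrA cW // -[W * _ * V]mulrA cV; last by lia.
  by rewrite mulrA -[_ * h k * W]mulrA cW // !mulrA.
- rewrite !mulrA -[_ * W * W]mulrA WW -[W * U * W]mulrA -[_ * V]mulrA sandwich //.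
  have Wv : W * Z a n = W by apply: (interval_mulr absZ); lia.
  have vW : Z a n * W = W by apply: (interval_mull absZ); lia.
  rewrite !mulrA Wv -[_ * Z a n * W]mulrA vW.
  have sW : s * W = W by apply: (interval_absl absZ); lia.
  have Ws : W * s = W by apply: (interval_absr absZ); lia.
  case: t sep => -[sT Ts].
    by rewrite -{1}Ws -[W * s * T]mulrA sT mulr0 mul0r.
  by rewrite -{2}sW -!mulrA [T * _]mulrA Ts mul0r mulr0.
move=> c def_a; move: (lt); rewrite /W {cW}; subst a; rewrite -/W => {}lt.
(* Now [a] is [c.+1]: [y] covers the nodes from [c] to [c + n], [W] those from [c.+1] to [c + n.+1],
   and [X] all of them, with [q] and [s] the generators of the first and last node. *)
set q := h c; set y := Z c n.+1; set X := Z c n.+2.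
have qWy : q * W * y = X by apply: (interval_mirror_shiftl fam absZ); lia.
have yWq : y * W * q = X by apply: (interval_mirror_shiftr fam absZ); lia.
have syW : s * y * W = X.
  by rewrite /s addSnnS; apply: (interval_shiftl fam absZ); lia.
have Wys : W * y * s = X.
  by rewrite /s addSnnS; apply: (interval_shiftr fam absZ); lia.
have qX : q * X = X by apply: (interval_absl absZ); lia.
have Xq : X * q = X by apply: (interval_absr absZ); lia.
have sX : s * X = X by apply: (interval_absl absZ); lia.
have Xs : X * s = X by apply: (interval_absr absZ); lia.
have -> : W * U * W * q * (W * V * W) = W * y * T * y * W.
  have WqW : W * q * W = X by apply: (interval_mirror_double fam absZ); lia.
  have UXV : U * X * V = y * T * y by apply: sandwich; lia.
  transitivity (W * (y * T * y) * W); last by rewrite !mulrA.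
  by rewrite -UXV -WqW !mulrA.
case: t sep => -[sT Ts] /=; split.
- by rewrite !mulrA qWy -Xs -[_ * s * T]mulrA sT mulr0 !mul0r.
- have -> : W * y * T * y * W = W * y * T * X by rewrite -{1}Ts -syW !mulrA.
  by rewrite -mulrA Xq.
- have -> : W * y * T * y * W = X * T * y * W by rewrite -{1}sT -Wys !mulrA.
  by rewrite !mulrA qX.
have -> : W * y * T * y * W * q = W * y * T * X by rewrite -yWq !mulrA.
by rewrite -sX mulrA -[_ * T * s]mulrA Ts mulr0 mul0r.
Qed.
End Step.

Lemma separated_start (A : pzRingType) M (h : nat -> A) b : hecke_family M h ->
  (b < M)%N -> separated true h b (h b) (1 - h b).
Proof.
move=> fam ltb; have bb := family_idem fam ltb.
split=> [k ltk|k ltk||c def_b].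
- exact: (family_comm fam).
- by rewrite mulrBl mulrBr mul1r mulr1 (family_comm fam).
- by rewrite mulrBr mulr1 bb subrr.
subst b; have cc : h c * h c = h c by apply: (family_idem fam); lia.
have -> /= : h c.+1 * h c * (1 - h c.+1) = h c.+1 * h c - h c * h c.+1 * h c.
  by rewrite mulrBr mulr1 (family_braid fam).
split; first by rewrite mulrBr !mulrA cc subrr.
by rewrite mulrBl -!mulrA cc.
Qed.

(** * Diagram demipotents *)

Fixpoint consecutive (k : nat) (B : seq (bool * seq nat)) (e : nat) : Prop :=
  if B is b :: B' then
    exists2 n, b.2 = iota k n.+1 & consecutive (k + n.+1) B' e
  else k = e.

Lemma blocks_from_consecutive k D :
  consecutive k (blocks_from k D) (k + size D).
Proof.
elim: D k => [|s D IH] k /=; first by rewrite addn0.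
rewrite addnS -addSn; case: (blocks_from k.+1 D) (IH k.+1) => [|[s' P] B] /=.
  by move=> <-; exists 0 => //; rewrite addn1.
case=> n -> cB; case: (s == s') => /=.
  by exists n.+1; rewrite // addnS -addSn.
by exists 0 => //; rewrite addn1; exists n.
Qed.

Lemma consecutive_rcons k B b e : consecutive k (rcons B b) e ->
  exists a n, [/\ b.2 = iota a n.+1, (k <= a)%N & e = (a + n.+1)%N].
Proof.
elim: B k => [|c B IH] k /= [n Eb].
  by move=> <-; exists k, n; split.
by move=> /IH [a [m [-> le ->]]]; exists a, m; split=> //; lia.
Qed.

(** [blocks_from] recurses from the left end, whereas the tree of diagrams grows at the right
    end. *)
Variant blocks_from_rcons_spec k D s : Prop :=
| BlocksExtend B P of blocks_from k D = rcons B (s, P)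
    & blocks_from k (rcons D s) = rcons B (s, rcons P (k + size D)%N)
| BlocksNew of
    blocks_from k (rcons D s) = rcons (blocks_from k D) (s, [:: (k + size D)%N]).

Lemma blocks_from_rconsP k D s : blocks_from_rcons_spec k D s.
Proof.
elim: D k => [|d D IH] k; first by apply: BlocksNew; rewrite /= addn0.
have sz : (k + size (d :: D) = k.+1 + size D)%N by rewrite /= addnS.
case: (IH k.+1) => [B P E1 E2|E].
  case: B E1 E2 => [|[s1 P1] B] E1 E2.
    have [ds|ds] := boolP (d == s).
      apply: (@BlocksExtend _ _ _ [::] (k :: P));
        by rewrite /= ?E1 ?E2 /= ds (eqP ds) // addnS.
    apply: (@BlocksExtend _ _ _ [:: (d, [:: k])] P);
      by rewrite /= ?E1 ?E2 /= (negPf ds) // addnS.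
  have [ds|ds] := boolP (d == s1).
    apply: (@BlocksExtend _ _ _ ((d, k :: P1) :: B) P);
      by rewrite /= ?E1 ?E2 /= ds // addnS.
  apply: (@BlocksExtend _ _ _ [:: (d, [:: k]), (s1, P1) & B] P);
    by rewrite /= ?E1 ?E2 /= (negPf ds) // addnS.
have [E0|[[s1 P1] [B E0]]] : blocks_from k.+1 D = [::] \/
  exists b B, blocks_from k.+1 D = b :: B.
- by case: (blocks_from k.+1 D) => [|b B]; [left|right; exists b, B].
- have [ds|ds] := boolP (d == s).
    apply: (@BlocksExtend _ _ _ [::] [:: k]);
      by rewrite /= ?E ?E0 /= ?ds ?(eqP ds) // addnS.
  by apply: BlocksNew; rewrite /= E E0 /= (negPf ds) addnS.
by apply: BlocksNew; rewrite /= E E0 /=; case: (d == s1); rewrite addnS.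
Qed.

Section Diagrams.
Variables (A : pzRingType) (M : nat) (g : bool -> nat -> A).
Variable w : bool * seq nat -> A.
Hypothesis gN : forall s k, g (~~ s) k = 1 - g s k.
Hypothesis fam : forall s, hecke_family M (g s).
Hypothesis abs_w : forall s a n, (a + n <= M)%N ->
  absorber (g s) (iota a n) (w (s, iota a n)).

Lemma gNE s : g (~~ s) = fun k => 1 - g s k.
Proof. by apply/funext => k. Qed.

(** Induction on the blocks, the later ones being conjugated first. For a block of sign - the
    invariant is moved to the complementary generators and back, so [t] is negated twice. *)
Lemma separated_blocks t k B e U V : (e <= M)%N -> consecutive k B e ->
  separated t (g true) e U V ->
  let L := \prod_(b <- B) w b in let R := \prod_(b <- rev B) w b in
  separated t (g true) k (L * U * R) (L * V * R).
Proof.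
move=> le_e; elim: B k => [|[s P] B IH] k /=.
  by move=> ->; rewrite !big_nil !mul1r !mulr1.
case=> n -> cB sepUV; have {IH} := IH _ cB sepUV.
rewrite big_cons rev_cons big_rcons /= -[k :: _]/(iota k n.+1).
move: (\prod_(b <- B) _) (\prod_(b <- rev B) _) => L R sep.
have ltn : (k + n < M)%N.
  suff : (k + n.+1 <= e)%N by lia.
  elim: B (k + n.+1)%N cB {sep} => [|[s' P'] B IH] m /= => [->//|[p _ /IH]]; lia.
have step s' := separated_block (fam s') (abs_w s') ltn.
set W := w _.
have E X : W * L * X * (R * W) = W * (L * X * R) * W by rewrite !mulrA.
rewrite !E /W {W cB E}; case: s; first exact: step.
have sepN : separated (~~ t) (g false) (k + n.+1) (L * U * R) (L * V * R).
  by rewrite (gNE true); apply: separated_1B.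
by have := separated_1B (step _ _ _ _ sepN); rewrite -gNE negbK.
Qed.

Definition prodL D := \prod_(b <- blocks D) w b.
Definition prodR D := \prod_(b <- rev (blocks D)) w b.

Lemma separated_diag t D U V : (size D <= M)%N ->
  separated t (g true) (size D) U V ->
  (prodL D * U * prodR D) * (prodL D * V * prodR D) = 0.
Proof.
by move=> le /(separated_blocks le (blocks_from_consecutive 0 D)) [].
Qed.

(** The two copies of the last block in the middle merge by idempotence. An extended block is then
    opened by [interval_double] around the new generator; a new block is that generator itself. *)
Lemma prodLR_rcons D s : (size D < M)%N ->
  prodL (rcons D s) * prodR (rcons D s) = prodL D * g s (size D) * prodR D.
Proof.
move=> lt; rewrite /prodL /prodR /blocks.
have cons_D := blocks_from_consecutive 0 D; have abs := abs_w s.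
case: (blocks_from_rconsP 0 D s) => [B P ED|] ->; rewrite ?ED !rev_rcons;
    rewrite !big_rcons !big_cons /= add0n.
  rewrite ED in cons_D; have [a [n [/= -> _]]] := consecutive_rcons cons_D.
  rewrite add0n => sz; rewrite sz.
  have -> : rcons (a :: iota a.+1 n) (a + n.+1) = iota a n.+2.
    by rewrite -cats1 -[a :: _]/(iota a n.+1) -[in RHS]addn1 iotaD.
  rewrite -[a :: iota a.+1 n]/(iota a n.+1).
  have ww : w (s, iota a n.+2) * w (s, iota a n.+2) = w (s, iota a n.+2).
    by apply: (interval_mull abs); lia.
  rewrite mulrA -[_ * _ * w (s, iota a n.+2)]mulrA ww.
  by rewrite -(interval_double (fam s) abs) ?mulrA //; lia.
have ww : w (s, iota (size D) 1) * w (s, iota (size D) 1) = w (s, iota (size D) 1).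
  by apply: (interval_mull abs); lia.
have <- : w (s, iota (size D) 1) = g s (size D).
  have := interval_shiftl (fam s) abs (a := size D) (n := 0).
  by rewrite addn0 => <- //; rewrite !(interval0 abs) ?mulr1 //; lia.
by rewrite mulrA -[_ * _ * w (s, _)]mulrA ww.
Qed.

Definition prodC D := prodL D * prodR D.

Lemma prodC_siblings D s : (size D < M)%N ->
  prodC (rcons D s) * prodC (rcons D (~~ s)) = 0.
Proof.
move=> lt; rewrite /prodC !prodLR_rcons // gN; have le := ltnW lt.
case: s; first exact: separated_diag le (separated_start (fam true) lt).
(* The start for [g false] has [U = 1 - p]; complementing returns to the family [g true], with
   [t = false]. *)
have := separated_1B (separated_start (fam false) lt); rewrite -gNE.
exact: separated_diag le.
Qed.

Lemma prodC_sum D : (size D < M)%N ->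
  prodC (rcons D true) + prodC (rcons D false) = prodC D.
Proof.
move=> lt; rewrite /prodC !prodLR_rcons // -mulrDl -mulrDr -[false]/(~~ true) gN.
by rewrite addrC subrK mulr1.
Qed.
End Diagrams.

(** * Signed generators of the 0-Hecke algebra *)

Section Algebra.
Variables (K : fieldType) (N : nat).
Local Notation A := (hecke_algebra K N).

(** Nodes are natural numbers so that intervals can be shifted and reflected. Out of range the value
    is 0 for + and 1 for -, which keeps [signed_genN] true for every [k]. *)
Definition signed_gen (s : bool) (k : nat) : A :=
  let g := oapp (@hecke_gen K N) 0 (insub k) in if s then g else 1 - g.

Lemma signed_genN s : (fun k => 1 - signed_gen s k) = signed_gen (~~ s).
Proof. by apply/funext => k; rewrite /signed_gen; case: s; rewrite ?subKr. Qed.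

Lemma signed_genE s (i : 'I_N.-1) :
  signed_gen s i = if s then hecke_gen K i else hecke_bar K i.
Proof. by rewrite /signed_gen valK. Qed.

Lemma signed_gen_cong s (u v : seq 'I_N.-1) : hecke_cong u v ->
  \prod_(i <- u) signed_gen s i = \prod_(i <- v) signed_gen s i.
Proof.
rewrite !(eq_bigr _ (fun (i : 'I_N.-1) _ => signed_genE s i)).
case: s; last exact: hecke_bar_cong.
by move=> /hecke_wordP E; rewrite -!hecke_elt_word E.
Qed.

Lemma signed_gen_family s : hecke_family N.-1 (signed_gen s).
Proof.
have rel u v (h : hecke_rel u v) := signed_gen_cong s (hecke_rel_cat [::] h).
split=> [k ltk|k l ltkl ltl|k ltk].
- by have := rel _ _ (hecke_idem (Ordinal ltk)); rewrite !big_cons !big_nil !mulr1.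
- have ltk : (k < N.-1)%N by lia.
  have := @rel [:: Ordinal ltk; Ordinal ltl] [:: Ordinal ltl; Ordinal ltk].
  rewrite /= !big_cons !big_nil !mulr1; apply; apply: hecke_comm.
  by apply/orP; left.
have := rel _ _ (@hecke_braid _ (Ordinal (ltnW ltk)) (Ordinal ltk) erefl).
by rewrite !big_cons !big_nil !mulr1 !mulrA.
Qed.

Definition interval_w (s : bool) (a n : nat) : A :=
  hecke_w K s [set i : 'I_N.-1 | (i : nat) \in iota a n].

Lemma hecke_w_word s J u : longest J = hecke_word u ->
  hecke_w K s J = \prod_(i <- u) signed_gen s (i : 'I_N.-1).
Proof.
rewrite (eq_bigr _ (fun (i : 'I_N.-1) _ => signed_genE s i)) /hecke_w => ->.
by case: s; rewrite ?hecke_psi_elt ?hecke_elt_word ?hecke_bar_prod_word.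
Qed.

(** The generators of either sign satisfy the Hecke relations, so the absorption properties of a
    word for the longest element hold for both; the other fields follow by running through its
    letters. *)
Lemma interval_w_absorber s a n : (a + n <= N.-1)%N ->
  absorber (signed_gen s) (iota a n) (interval_w s a n).
Proof.
move=> le; have [u [uJ def_w absl absr]] :=
  longest_word [set i : 'I_N.-1 | (i : nat) \in iota a n].
have in_u (i : 'I_N.-1) : i \in u -> (i : nat) \in iota a n.
  by move=> /(allP uJ); rewrite inE.
have in_J k : k \in iota a n ->
    exists2 i : 'I_N.-1, k = i & i \in [set i : 'I_N.-1 | (i : nat) \in iota a n].
  rewrite mem_iota => kP; have ltk : (k < N.-1)%N by lia.
  by exists (Ordinal ltk); rewrite ?inE ?mem_iota.
rewrite /interval_w (hecke_w_word _ def_w).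
split=> [_ /in_J[i -> iJ]|_ /in_J[i -> iJ]|m|m|m].
- by move/hecke_wordP/(signed_gen_cong s): (absl i iJ); rewrite big_cons.
- by move/hecke_wordP/(signed_gen_cong s): (absr i iJ); rewrite big_rcons.
- move=> abs_m; elim: u in_u {uJ def_w absl absr} => [|i u IH] in_u.
    by rewrite big_nil mul1r.
  rewrite big_cons -mulrA IH => [|j ju]; last by apply: in_u; rewrite inE ju orbT.
  by apply/abs_m/in_u/mem_head.
- move=> abs_m; elim: u in_u {uJ def_w absl absr} => [|i u IH] in_u.
    by rewrite big_nil mulr1.
  rewrite big_cons mulrA abs_m; last exact/in_u/mem_head.
  by apply: IH => j ju; apply: in_u; rewrite inE ju orbT.
move=> comm_m; rewrite big_seq; apply: commr_sym; apply: commr_prod => i /in_u.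
by move=> /comm_m; apply: commr_sym.
Qed.

End Algebra.

(** * Idempotents from orthogonal siblings *)

Section BinaryTree.
Variables (A : pzRingType) (M : nat) (C : seq bool -> A).
Hypothesis C0 : C [::] = 1.
Hypothesis C_siblings : forall D s, (size D < M)%N ->
  C (rcons D s) * C (rcons D (~~ s)) = 0.
Hypothesis C_sum : forall D, (size D < M)%N ->
  C (rcons D true) + C (rcons D false) = C D.

Lemma parentE D s : (size D < M)%N -> C D = C (rcons D s) + C (rcons D (~~ s)).
Proof. by move=> lt; rewrite -C_sum //; case: s; rewrite // addrC. Qed.

Lemma child_mul_parent D s : (size D < M)%N ->
  C (rcons D s) * C D = C (rcons D s) * C (rcons D s).
Proof. by move=> lt; rewrite (parentE s lt) mulrDr C_siblings // addr0. Qed.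

Lemma parent_mul_child D s : (size D < M)%N ->
  C D * C (rcons D s) = C (rcons D s) * C (rcons D s).
Proof.
move=> lt; have := C_siblings (~~ s) lt; rewrite negbK => C0s.
by rewrite (parentE s lt) mulrDl C0s addr0.
Qed.

(** All factors but one can be replaced by the parent, so powers can be studied by induction on the
    diagram. *)
Lemma child_expl D s k : (size D < M)%N ->
  C (rcons D s) ^+ k.+1 = C (rcons D s) * C D ^+ k.
Proof.
move=> lt; elim: k => [|k IH]; first by rewrite expr0 mulr1 expr1.
by rewrite exprS {}IH mulrA -child_mul_parent // -mulrA -exprS.
Qed.

Lemma child_expr D s k : (size D < M)%N ->
  C (rcons D s) ^+ k.+1 = C D ^+ k * C (rcons D s).
Proof.
move=> lt; elim: k => [|k IH]; first by rewrite expr0 mul1r expr1.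
by rewrite exprSr {}IH -mulrA -parent_mul_child // mulrA -exprSr.
Qed.

(** [child_expl] lowers the size and the exponent together, down to the empty diagram, where [C] is
    1. *)
Lemma C_stable D k : (size D <= M)%N -> (size D <= k)%N ->
  C D ^+ k = C D ^+ size D.
Proof.
elim/last_ind: D k => [|D s IH] k; first by rewrite C0 !expr1n.
rewrite size_rcons => lt; case: k => // k le.
by rewrite !child_expl // IH // ltnW.
Qed.

Lemma C_prod_take D : (size D <= M)%N ->
  \prod_(1 <= i < (size D).+1) C (take i D) = C D ^+ size D.
Proof.
elim/last_ind: D => [|D s IH]; first by rewrite big_nil.
rewrite size_rcons => lt; rewrite big_nat_recr //= take_oversize ?size_rcons //.
rewrite child_expr // -IH; last exact: ltnW.
congr (_ * _); apply: eq_big_nat => i /andP[_ lti].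
by rewrite -cats1 takel_cat.
Qed.

(** Summing over the last sign turns [C (rcons D s) * C D ^+ k] into [C D ^+ k.+1]. The exponent has
    to be positive: with exponent 0 the sum would count the diagrams. *)
Lemma C_sum_exp n k : (n <= M)%N -> \sum_(D : n.-tuple bool) C D ^+ k.+1 = 1.
Proof.
elim: n k => [|n IH] k le.
  rewrite (eq_bigr (fun=> 1)) => [|D _]; last by rewrite tuple0 C0 expr1n.
  by rewrite sumr_const card_tuple expn0.
pose f (p : n.-tuple bool * bool) : n.+1.-tuple bool := [tuple of rcons p.1 p.2].
have f_bij : bijective f.
  apply: inj_card_bij => [[D s] [D' s'] /(congr1 val) /= /rcons_inj [E ->]|].
    by congr pair; apply: val_inj.
  by rewrite card_prod !card_tuple card_bool expnSr.
rewrite (reindex f) /=; last exact: onW_bij.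
rewrite -(pair_bigA _ (fun (D : n.-tuple bool) s => C (rcons D s) ^+ k.+1)) /=.
rewrite -[RHS](IH k (ltnW le)); apply: eq_bigr => D _.
have lt : (size D < M)%N by rewrite size_tuple.
by rewrite big_bool /= !child_expl // -mulrDl C_sum // exprS.
Qed.

(** Each sign of [E] costs one factor of the power; the strict inequality leaves at least one factor
    [C D]. *)
Lemma C_exp_prefix D E k : (size (D ++ E) <= M)%N -> (size E < k)%N ->
  (exists x, C (D ++ E) ^+ k = C D * x) /\ (exists x, C (D ++ E) ^+ k = x * C D).
Proof.
elim/last_ind: E k => [|E s IH] k; case: k => // k.
  by rewrite cats0 => _ _; split; exists (C D ^+ k); rewrite ?exprS // -exprSr exprS.
rewrite -rcons_cat !size_rcons => lt ltk.
have [[x Ex] [y Ey]] := IH k (ltnW lt) ltk; split.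
  by rewrite child_expr // Ex -mulrA; eexists.
by rewrite child_expl // Ey mulrA; eexists.
Qed.

Lemma seq_diverge (D D' : seq bool) : size D = size D' -> D != D' ->
  exists P s E E', D = rcons P s ++ E /\ D' = rcons P (~~ s) ++ E'.
Proof.
elim: D D' => [|d D IH] [|d' D'] //= [eq_sz].
have [<-|ne] := eqVneq d d'.
  rewrite eqseq_cons eqxx /= => /(IH _ eq_sz) [P [s [E [E' [-> ->]]]]].
  by exists (d :: P), s, E, E'.
by exists [::], d, D, D'; split=> //=; congr cons; move: ne; case: (d); case: (d').
Qed.

(** Where the diagrams diverge they have sibling prefixes. The left power ends with [C] of one
    sibling and the right power begins with [C] of the other. *)
Lemma C_exp_orthogonal D D' k : size D = size D' -> D != D' ->
  (size D <= M)%N -> (size D <= k)%N -> C D ^+ k * C D' ^+ k = 0.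
Proof.
move=> eq_sz /(seq_diverge eq_sz) [P [s [E [E' [ED ED']]]]] le lek; subst D D'.
have le' := le; have lek' := lek; rewrite eq_sz in le' lek'.
have ltP : (size P < M)%N.
  by apply: leq_trans le; rewrite size_cat size_rcons leq_addr.
have ltk Q b (F : seq bool) : (size (rcons Q b ++ F) <= k)%N -> (size F < k)%N.
  by apply: leq_trans; rewrite size_cat size_rcons addSn ltnS leq_addl.
have [_ [x ->]] := C_exp_prefix le (ltk _ _ _ lek).
have [[y ->] _] := C_exp_prefix le' (ltk _ _ _ lek').
by rewrite -mulrA [C _ * (C _ * _)]mulrA C_siblings // mul0r mulr0.
Qed.
End BinaryTree.

(** If [e = f + g] is an orthogonal decomposition, all characters but that of [D] vanish on [f] and
    [g], and that of [D] vanishes on one of them, its values lying in a domain. This one is then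
    zero. *)
Lemma primitive_of_characters (A : pzRingType) (K : idomainType) (T : eqType)
    (chi : T -> {rmorphism A -> K}) (D : T) (e : A) :
  (forall f, idempotent_elt f -> (forall S, chi S f = 0) -> f = 0) ->
  idempotent_elt e -> (forall S, chi S e = (S == D)%:R) -> primitive_idempotent e.
Proof.
move=> ker_chi idem_e chi_e; split=> //.
  apply/eqP => e0; have := chi_e D.
  by rewrite e0 rmorph0 eqxx => /eqP; rewrite eq_sym oner_eq0.
move=> f g idem_f idem_g [fg _] def_e.
have chi_f S : S != D -> chi S f = 0.
  move=> /negPf neq; have := chi_e S; rewrite neq def_e.
  move=> /(congr1 ( *%R (chi S f))).
  by rewrite -rmorphM mulrDr fg idem_f addr0 mulr0.
have chi_g S : S != D -> chi S g = 0.
  by move=> neq; have := chi_e S; rewrite (negPf neq) def_e rmorphD chi_f // add0r.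
have /eqP : chi D f * chi D g = 0 by rewrite -rmorphM fg rmorph0.
rewrite mulf_eq0 => /orP[] /eqP chi0; [left|right]; apply: ker_chi => // S;
  have [->//|] := eqVneq S D; auto.
Qed.

(** * Characters *)

Section Characters.
Variables (K : fieldType) (N : nat).
Local Notation A := (hecke_algebra K N).
Implicit Types (D : N.-1.-tuple bool) (x y z : hecke_monoid N).

Definition char_monoid D x : K := (all (tnth D) (repr x))%:R.

Lemma all_hecke_cong D (u v : seq 'I_N.-1) :
  hecke_cong u v -> all (tnth D) u = all (tnth D) v.
Proof.
elim=> [//|x y _ -> //|y x w _ -> _ -> //|p s x y h].
rewrite !all_cat; congr (_ && (_ && _)).
by case: h => [i|i j _|i j _] /=; do ![case: (tnth D _) => //].
Qed.

Lemma char_monoid_mmorphism D : mmorphism (char_monoid D).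
Proof.
split=> [x y|]; rewrite /char_monoid.
  by rewrite (all_hecke_cong D (repr_hecke_word _)) all_cat -natrM mulnb.
by rewrite (all_hecke_cong D (repr_hecke_word _)).
Qed.
HB.instance Definition _ D := isMultiplicative.Build (hecke_monoid N) K
  (char_monoid D) (char_monoid_mmorphism D).

Definition hecke_char D : {rmorphism A -> K} := mmap idfun (char_monoid D).

Lemma hecke_char_gen D (i : 'I_N.-1) : hecke_char D (hecke_gen K i) = (tnth D i)%:R.
Proof.
rewrite /hecke_char /= /hecke_gen /hecke_elt mmapU mul1r /char_monoid.
by rewrite (all_hecke_cong D (repr_hecke_word _)) /= andbT.
Qed.

(** Read as a signed diagram, this selects the character giving the diagonal entry at [y] of left
    multiplication. *)
Definition stabilizers y : N.-1.-tuple bool :=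
  [tuple `[< hecke_word (i :: repr y) = y >] | i < N.-1].

Lemma hecke_mul_fixed x y :
  (hecke_mul x y == y) = all (tnth (stabilizers y)) (repr x).
Proof.
apply/eqP/allP => [E i ix|fix_y].
  rewrite tnth_mktuple; apply/asboolP; rewrite -[RHS]hecke_wordK.
  by apply: (hecke_length_cat_eq _ ix); rewrite -/(hecke_mul x y) hecke_wordK E.
rewrite -[RHS]hecke_wordK; apply: hecke_word_absorb => i /fix_y.
by rewrite tnth_mktuple hecke_wordK => /asboolP.
Qed.

Lemma hecke_mul_length x y : (hecke_length y <= hecke_length (hecke_mul x y))%N.
Proof. by rewrite -{1}(hecke_wordK y) hecke_length_cat. Qed.

Lemma hecke_mul_length_eq x y :
  hecke_length (hecke_mul x y) = hecke_length y -> hecke_mul x y = y.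
Proof.
rewrite -{2}(hecke_wordK y) => /hecke_length_cat_eq E.
by rewrite /hecke_mul hecke_word_absorb // hecke_wordK.
Qed.

(* [x * y] is either [y], when every letter of [x] fixes [y], or longer than [y]:
   left multiplication is triangular with the characters on the diagonal. *)
Lemma char_ker_length (a b : A) k : (forall D, hecke_char D a = 0) ->
  (forall y, y \in msupp b -> (k <= hecke_length y)%N) ->
  forall z, z \in msupp (a * b) -> (k < hecke_length z)%N.
Proof.
move=> chi_a le_b z; rewrite -mcoeff_neq0; apply: contra_neqT.
rewrite -leqNgt => le_z.
rewrite mcoeffMr big_seq big1 // => y /le_b le_y.
have [<-|ne_yz] := eqVneq y z.
  (* The terms with [y = z] come from the [x] that fix [y]; they add up to [b@_y] times the value of
     this character at [a]. *)
  have := chi_a (stabilizers y); rewrite /hecke_char /= mmapE => chi0.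
  transitivity (\sum_(x <- msupp a)
    idfun a@_x * char_monoid (stabilizers y) x * b@_y).
    by apply: eq_bigr => x _; rewrite /char_monoid -hecke_mul_fixed mulrAC mulr_natr.
  by rewrite -mulr_suml chi0 mul0r.
rewrite big1 // => x _; case: eqP => // xy; case/eqP: ne_yz.
rewrite -xy; apply/esym/hecke_mul_length_eq.
apply/eqP; rewrite eqn_leq hecke_mul_length andbT.
by rewrite [hecke_mul x y]xy; apply: leq_trans le_y.
Qed.

(** Writing [f] as [f * f] raises the lower bound on the lengths in its support indefinitely,
    although lengths are bounded. *)
Lemma char_ker_idempotent (f : A) : idempotent_elt f ->
  (forall D, hecke_char D f = 0) -> f = 0.
Proof.
move=> ff chi_f; have le_f k : forall y, y \in msupp f -> (k <= hecke_length y)%N.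
  by elim: k => // k IH y; rewrite -{1}ff; apply: char_ker_length.
apply/malgP => y; rewrite mcoeff0; apply/eqP; rewrite mcoeff_eq0.
apply/negP => /(le_f (N * N).+1); rewrite ltnNge hecke_length_leq //.
Qed.
End Characters.

(** * The 0-Hecke algebra *)

Section Main.
Variables (K : fieldType) (N : nat).
Local Notation A := (hecke_algebra K N).
Local Notation C := (diagC K N).

Let genN s k : signed_gen K N (~~ s) k = 1 - signed_gen K N s k.
Proof. by rewrite -signed_genN. Qed.

Lemma diagC_nil : C [::] = 1.
Proof. by rewrite /diagC /diagL /diagR /= !big_nil mulr1. Qed.

Lemma diagC_siblings D s : (size D < N.-1)%N ->
  C (rcons D s) * C (rcons D (~~ s)) = 0.
Proof.
exact: (prodC_siblings genN (@signed_gen_family K N) (@interval_w_absorber K N)).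
Qed.

Lemma diagC_sum D : (size D < N.-1)%N -> C (rcons D true) + C (rcons D false) = C D.
Proof.
exact: (prodC_sum genN (@signed_gen_family K N) (@interval_w_absorber K N)).
Qed.

(** Values of a character commute, so the factor of the last node can be pulled out from between [L]
    and [R]; it is 1 or 0 according to whether the last signs agree. *)
Lemma hecke_char_diagC (D : N.-1.-tuple bool) E : (size E <= N.-1)%N ->
  hecke_char K D (C E) = (take (size E) D == E)%:R.
Proof.
elim/last_ind: E => [_|E s IH]; first by rewrite diagC_nil rmorph1 take0.
rewrite size_rcons => lt; have := IH (ltnW lt).
have -> : C (rcons E s) = diagL K N E * signed_gen K N s (size E) * diagR K N E.
  exact: (prodLR_rcons (@signed_gen_family K N) (@interval_w_absorber K N)).
rewrite !rmorphM mulrAC => ->.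
have -> : signed_gen K N s (size E) = signed_gen K N s (Ordinal lt) by [].
rewrite signed_genE (take_nth false) ?size_tuple // eqseq_rcons.
rewrite -[nth _ _ _](tnth_nth false D (Ordinal lt)).
set i := Ordinal lt.
have -> : hecke_char K D (if s then hecke_gen K i else hecke_bar K i) =
    (tnth D i == s)%:R.
  case: s; rewrite ?rmorphB ?rmorph1 hecke_char_gen; case: (tnth _ _);
    by rewrite ?subrr ?subr0.
by rewrite -natrM mulnb.
Qed.

Lemma diagI_exp (D : N.-1.-tuple bool) k : (0 < N)%N -> (N.-1 <= k)%N ->
  diagI K N D = C D ^+ k.
Proof.
move=> N_gt0 le_k; have szD : size D = N.-1 by rewrite size_tuple.
have le_D : (size D <= N.-1)%N by rewrite szD.
have le_Dk : (size D <= k)%N by rewrite szD.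
rewrite (C_stable diagC_nil diagC_siblings diagC_sum le_D le_Dk).
rewrite -(C_prod_take diagC_siblings diagC_sum le_D) /diagI.
by rewrite szD prednK.
Qed.
End Main.

Theorem theorem4p7 (R : realType) (N : nat) (hN : (1 <= N)%N) :
  [/\ (forall D : N.-1.-tuple bool,
         [/\ demipotent (diagC R[i] N D),
             idempotent_elt (diagI R[i] N D)
           & diagI R[i] N D = diagC R[i] N D ^+ N]),
      (forall D D' : N.-1.-tuple bool, D != D' ->
         orthogonal_elts (diagI R[i] N D) (diagI R[i] N D')),
      (forall D : N.-1.-tuple bool, primitive_idempotent (diagI R[i] N D))
    & \sum_(D : N.-1.-tuple bool) diagI R[i] N D = 1].
Proof.
pose K : fieldType := R[i]; rewrite -/K.
have C0 := diagC_nil K N.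
have IE (D : N.-1.-tuple bool) k : (N.-1 <= k)%N -> diagI K N D = diagC K N D ^+ k.
  exact: diagI_exp.
have idem (D : N.-1.-tuple bool) : idempotent_elt (diagI K N D).
  (* All exponents from [N.-1] on give the same power, in particular [N.-1 + N.-1]. *)
  rewrite /idempotent_elt (IE D _ (leqnn _)) -exprD -!IE //; exact: leq_addr.
have orth (D D' : N.-1.-tuple bool) : D != D' -> diagI K N D * diagI K N D' = 0.
  move=> neq; rewrite !(IE _ _ (leqnn _)).
  by apply: (C_exp_orthogonal (@diagC_siblings K N) (@diagC_sum K N));
    rewrite ?size_tuple.
split=> [D|D D' neq|D|].
- split=> //; last by apply: IE; apply: leq_pred.
  by exists N.-1; rewrite -!IE.
- by split; apply: orth; rewrite // eq_sym.
- apply: (primitive_of_characters (chi := @hecke_char K N) (D := D)) => //.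
    exact: char_ker_idempotent.
  (* The exponent [N], positive by [hN], is chosen so that [0 ^+ N = 0] for the characters other
     than that of [D]. *)
  move=> S; rewrite (IE D N (leq_pred N)) rmorphXn /= hecke_char_diagC ?size_tuple //.
  rewrite take_oversize ?size_tuple // -val_eqE.
  by case: eqP => _; rewrite ?expr1n // expr0n eqn0Ngt hN.
(* [C_sum_exp] is stated for successor exponents, hence [N.-1.+1]. *)
rewrite (eq_bigr (fun D : N.-1.-tuple bool => diagC K N D ^+ N.-1.+1)) => [|D _].
  exact: (C_sum_exp C0 (@diagC_siblings K N) (@diagC_sum K N)).
by apply: IE.
Qed.
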